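(* Let $G$ be a graph of order $n\ge 2$ and maximum degree $\Delta(G)=n-2$. Then $\mathcal{A}(G)\le \frac{n^2-n+1}{n}$, with equality if and only if $G$ is isomorphic to $K_{n-1}\cup K_1$ (the disjoint union of a complete graph on $n-1$ vertices and an isolated vertex).
   Context: Graphs are finite and simple. For a graph $G$ of order $n$ and an integer $k$, $S(G,k)$ denotes the number of partitions of $V(G)$ into exactly $k$ nonempty stable sets (non-equivalent colorings with exactly $k$ colors). Let $\mathcal{B}(G)=\sum_{k=1}^n S(G,k)$, $\mathcal{T}(G)=\sum_{k=1}^n kS(G,k)$, and $\mathcal{A}(G)=\mathcal{T}(G)/\mathcal{B}(G)$. $G\cup H$ denotes the disjoint union of graphs. *)

(* Defs.v *)
From HB Require Import structures.
From mathcomp Require Import all_boot all_order all_algebra.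

Set Implicit Arguments.
Unset Strict Implicit.
Unset Printing Implicit Defensive.

Import Order.TTheory GRing.Theory Num.Theory.

Record sgraph := SGraph {
  vertex :> finType;
  adj : rel vertex;
  adj_sym : symmetric adj;
  adj_irrefl : irreflexive adj
}.

Definition graph_order (G : sgraph) : nat := #|G|.

Definition degree (G : sgraph) (v : G) : nat := #|[set w : G | adj v w]|.

Definition max_degree (G : sgraph) : nat := \max_(v : G) degree v.

Definition stable (G : sgraph) (A : {set G}) : bool :=
  [forall u in A, forall v in A, ~~ adj u v].

(* [partition] already requires the blocks to be nonempty. *)
Definition colorings (G : sgraph) (k : nat) : {set {set {set G}}} :=
  [set P : {set {set G}} | [&& partition P [set: G],
                               [forall A in P, stable A] & #|P| == k]].

Definition num_colorings (G : sgraph) (k : nat) : nat := #|colorings G k|.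

Definition total_colorings (G : sgraph) : nat :=
  \sum_(1 <= k < (graph_order G).+1) num_colorings G k.

Definition total_colors (G : sgraph) : nat :=
  \sum_(1 <= k < (graph_order G).+1) k * num_colorings G k.

Definition avg_colors (G : sgraph) : rat :=
  ((total_colors G)%:R / (total_colorings G)%:R)%R.

Definition isomorphic (G H : sgraph) : Prop :=
  exists2 f : G -> H, bijective f & forall u v : G, adj (f u) (f v) = adj u v.

Definition complete_rel (n : nat) : rel 'I_n := fun i j => i != j.

Lemma complete_rel_sym n : symmetric (@complete_rel n).
Proof. by move=> i j; rewrite /complete_rel eq_sym. Qed.

Lemma complete_rel_irrefl n : irreflexive (@complete_rel n).
Proof. by move=> i; rewrite /complete_rel eqxx. Qed.

Definition complete_graph (n : nat) : sgraph :=
  SGraph (@complete_rel_sym n) (@complete_rel_irrefl n).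

Definition union_rel (G H : sgraph) : rel (G + H)%type := fun x y =>
  match x, y with
  | inl u, inl v => adj u v
  | inr u, inr v => adj u v
  | _, _ => false
  end.

Lemma union_rel_sym (G H : sgraph) : symmetric (@union_rel G H).
Proof. by case=> u [] v //=; apply: adj_sym. Qed.

Lemma union_rel_irrefl (G H : sgraph) : irreflexive (@union_rel G H).
Proof. by case=> u /=; apply: adj_irrefl. Qed.

Definition disjoint_union (G H : sgraph) : sgraph :=
  SGraph (@union_rel_sym G H) (@union_rel_irrefl G H).

(* Main.v *)
Require Import Defs.
From mathcomp Require Import all_boot all_order all_algebra.
From mathcomp Require Import zify ring.
Import Order.TTheory GRing.Theory Num.Theory.

Set Implicit Arguments.
Unset Strict Implicit.

(** Every stable partition other than the discrete one has at most [n - 1]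
    blocks, so [T <= (n - 1) B + 1] and [A <= n - 1 + 1/B]; it remains to see
    that [B >= n].  As the maximum degree is [n - 2], every vertex [v] has a
    non-neighbour [f v <> v].  Gluing [v] to [f v] gives [n] stable partitions,
    which coincide in pairs exactly along the 2-cycles of [f]; such a collision
    is repaired by also gluing a fixed 2-cycle [a, f a], or, for that 2-cycle
    itself, by using the discrete partition.  In case of equality no stable
    partition has fewer than [n - 1] blocks, so the complement of [G] has
    neither two disjoint edges nor a triangle; it has no isolated vertex
    either, hence it is a star. *)

(** * Partitions of a finite set as kernels of maps *)

Section KernelPartition.
Variable T : finType.
Implicit Types (f g : T -> T) (P : {set {set T}}).

Definition kernel_partition f : {set {set T}} := preim_partition f [set: T].

Lemma mem_pblock_kernel f x y :
  (y \in pblock (kernel_partition f) x) = (f x == f y).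
Proof.
rewrite pblock_equivalence_partition ?inE //.
by split=> // /eqP->.
Qed.

Lemma eq_kernel_partition f g :
  kernel_partition f = kernel_partition g -> forall x y, f x = f y -> g x = g y.
Proof.
by move=> E x y /eqP; rewrite -mem_pblock_kernel E mem_pblock_kernel => /eqP.
Qed.

Lemma card_kernel_partition f :
  #|kernel_partition f| <= #|[set f x | x in [set: T]]|.
Proof.
have -> : kernel_partition f =
    [set f @^-1: [set y] | y in [set f x | x in [set: T]]].
  rewrite -imset_comp /kernel_partition /preim_partition /equivalence_partition.
  apply: eq_imset => x /=; apply/setP=> y.
  by rewrite !inE /= eq_sym.
exact: leq_imset_card.
Qed.

Lemma card_kernel_partition_avoid2 f u v : u != v ->
  (forall x, f x != u) -> (forall x, f x != v) ->
  #|kernel_partition f| <= #|T| - 2.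
Proof.
move=> uv fu fv; apply: leq_trans (card_kernel_partition f) _.
have -> : #|T| - 2 = #|~: [set u; v]|.
  by rewrite [RHS]cardsCs setCK cards2 uv.
apply/subset_leq_card/subsetP=> _ /imsetP[x _ ->].
by rewrite !inE negb_or fu fv.
Qed.

(** [P] is the image of [pblock P]; when it has as many elements as [T], this map is injective and
    every block is a singleton. *)
Lemma card_partition_setT P : partition P [set: T] ->
  #|P| <= #|T| ?= iff (P == kernel_partition id).
Proof.
move=> partP; have [/eqP covP tiP P0] := and3P partP.
have imP : P = [set pblock P x | x in [set: T]].
  apply/setP=> A; apply/idP/imsetP=> [PA|[x _ ->]].
    have [x Ax] : exists x, x \in A.
      by apply/set0Pn; apply: contraNneq P0 => <-.
    by exists x; rewrite ?inE // (def_pblock tiP PA Ax).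
  by apply: pblock_mem; rewrite covP inE.
split; first by rewrite imP -cardsT; apply: leq_imset_card.
apply/eqP/eqP=> [cardP|->].
  have /imset_injP injP : #|[set pblock P x | x in [set: T]]| == #|[set: T]|
    by rewrite -imP cardP cardsT.
  rewrite -(preim_partition_pblock partP).
  apply: eq_imset => x; apply/setP=> y; rewrite !inE /=.
  by apply/eqP/eqP=> [|-> //]; apply: injP; rewrite inE.
have -> : kernel_partition id = [set [set x] | x in [set: T]].
  by apply: eq_imset => x; apply/setP=> y; rewrite !inE /= eq_sym.
by rewrite card_imset ?cardsT //; apply: set1_inj.
Qed.

(** The kernel merges [u] with [w] and keeps all other points apart. *)
Definition glue (u w x : T) : T := if x == u then w else x.

Lemma glueE u w : glue u w u = glue u w w.
Proof. by rewrite /glue eqxx; case: ifP. Qed.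

Lemma glue_inj u w x y : glue u w x = glue u w y ->
  [\/ x = y, x = u /\ y = w | x = w /\ y = u].
Proof.
rewrite /glue; case: eqP => [->|_]; case: eqP => [->|_] E.
- by constructor 1.
- by constructor 2.
- by constructor 3.
- by constructor 1.
Qed.

(** [glue u w] moves only [u], to [w]; as both lie outside [{a, b}], nothing but [a] and [b]
    themselves is sent to [a] or [b]. *)
Lemma glue2_inj a b u w x y :
  u != a -> u != b -> w != a -> w != b ->
  glue a b (glue u w x) = glue a b (glue u w y) ->
  [\/ glue u w x = glue u w y, x = a /\ y = b | x = b /\ y = a].
Proof.
move=> ua ub wa wb /glue_inj[?|[]|[]]; first by constructor 1.
- rewrite {1 2}/glue; case: eqP => [_ /eqP|_ ->]; first by rewrite (negPf wa).
  case: eqP => [_ /eqP|_ ->]; first by rewrite (negPf wb).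
  by constructor 2.
- rewrite {1 2}/glue; case: eqP => [_ /eqP|_ ->]; first by rewrite (negPf wb).
  case: eqP => [_ /eqP|_ ->]; first by rewrite (negPf wa).
  by constructor 3.
Qed.

End KernelPartition.


(** * One gluing per vertex, without repetition *)

Section MatchingInjection.
Variables (T : finType) (f : T -> T) (a : T).
Hypothesis f_neq : forall v, f v != v.
(* Without 2-cycles the second gluing is never used and [a] is arbitrary. *)
Hypothesis a_cycle : (exists v, f (f v) = v) -> f (f a) = a.

Definition cycle_first v := (f (f v) == v) && (enum_rank v < enum_rank (f v)).

(** Kept as a map, so that gluings compose and partitions are compared through kernels. Both [a] and
    [f a] are tested because [cycle_first] may select either. *)
Definition matching v : T -> T :=
  if cycle_first v then
    if (v == a) || (v == f a) then id else glue a (f a) \o glue v (f v)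
  else glue v (f v).

(** The two ends of a 2-cycle have distinct ranks, so [cycle_first] holds at exactly one of them. *)
Lemma cycle_first_eq v w : cycle_first v = cycle_first w ->
  (v = w \/ v = f w /\ f v = w) -> v = w.
Proof.
move=> E [//|[vfw fvw]]; move: E; rewrite /cycle_first -!vfw !fvw -!vfw !eqxx /=.
by case: ltngtP => // /ord_inj/enum_rank_inj.
Qed.

Lemma glue_edge_inj v w : glue w (f w) v = glue w (f w) (f v) ->
  v = w \/ v = f w /\ f v = w.
Proof.
case/glue_inj=> [E|[-> _]|[-> ->]]; [|by left|by right].
by move: (f_neq v); rewrite -E eqxx.
Qed.

Lemma cycle_first_disjoint v : cycle_first v -> ~~ ((v == a) || (v == f a)) ->
  [/\ v != a, v != f a, f v != a & f v != f a].
Proof.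
case/andP=> /eqP ffv _; rewrite negb_or => /andP[va vfa].
have ffa : f (f a) = a by apply: a_cycle; exists v.
split=> //; first by apply: contraNneq vfa => <-; rewrite ffv.
by apply: contraNneq va => E; rewrite -ffv E ffa.
Qed.

Lemma matching_edge v w : cycle_first v -> ~~ ((v == a) || (v == f a)) ->
  glue a (f a) (glue v (f v) w) = glue a (f a) (glue v (f v) (f w)) ->
  [\/ w = v \/ w = f v /\ f w = v, w = a | w = f a].
Proof.
move=> fv nv; case: (cycle_first_disjoint fv nv) => va vfa fva fvfa.
case/glue2_inj=> // [/glue_edge_inj|[]|[]]; first by constructor 1.
- by constructor 2.
- by constructor 3.
Qed.

Lemma matching_ker_inj v w :
  (forall x y, (matching v x = matching v y) <-> (matching w x = matching w y)) ->
  v = w.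
Proof.
wlog le_vw : v w / cycle_first w ==> cycle_first v.
  move=> IH K; case fw: (cycle_first w) (IH v w) (IH w v) => /=; last by move->.
  case: (cycle_first v) => /= [-> //|_ IH']; apply/esym/IH' => // x y.
  by split=> /K.
move=> K; have Kv x y := (K x y).1; have Kw x y := (K x y).2.
have fneq' x : x <> f x by apply/eqP; rewrite eq_sym f_neq.
case fv: (cycle_first v) le_vw => /=; last first.
  rewrite implybF => /negPf fw; move: (Kv v (f v)).
  rewrite /matching fv fw => /(_ (glueE _ _))/glue_edge_inj.
  by apply: cycle_first_eq; rewrite fv fw.
move=> _; have ffa : f (f a) = a.
  by apply: a_cycle; exists v; case/andP: fv => /eqP.
(* On the chosen 2-cycle [matching v] is the identity, so [matching w] merges nothing and [w] lies
   on that cycle too. *)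
case nv: ((v == a) || (v == f a)).
  move: (Kw w (f w)); rewrite /matching fv nv /=.
  case fw: (cycle_first w); last first.
    by move/(_ (glueE _ _)) => /fneq'.
  case nw: ((w == a) || (w == f a)) => /=; last first.
    by rewrite glueE => /(_ erefl) /fneq'.
  move=> _; apply: cycle_first_eq; first by rewrite fv fw.
  by case/orP: nv nw => /eqP-> /orP[] /eqP->; rewrite ?ffa; auto.
have [va vfa fva fvfa] := cycle_first_disjoint fv (negbT nv).
have [na nfa] : glue v (f v) a = a /\ glue v (f v) (f a) = f a.
  by rewrite /glue ![_ == v]eq_sym (negPf va) (negPf vfa).
have Ev : matching v v = matching v (f v).
  by rewrite /matching fv nv /= glueE.
have Ea : matching v a = matching v (f a).
  by rewrite /matching fv nv /= na nfa glueE.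
(* [matching w] must merge both of the disjoint pairs [{v, f v}] and [{a, f a}]: a single gluing or
   the identity cannot, and a double gluing does so only if [{v, f v}] is [{w, f w}]. *)
move: (Kv _ _ Ev) (Kv _ _ Ea); rewrite /matching.
case fw: (cycle_first w); last first.
  move=> /glue_edge_inj Hv /glue_edge_inj Ha.
  have : v = a \/ v = f a.
    by case: Hv Ha => [->|[-> _]] [->|[-> E]]; rewrite ?E; auto.
  by case=> E; [move: va|move: vfa]; rewrite E eqxx.
case nw: ((w == a) || (w == f a)) => /=; first by move/fneq'.
move=> /(matching_edge fw (negbT nw))[H _|E|E].
- by apply: cycle_first_eq H; rewrite fv fw.
- by move: va; rewrite E eqxx.
- by move: vfa; rewrite E eqxx.
Qed.

Lemma kernel_matching_inj : injective (fun v => kernel_partition (matching v)).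
Proof.
move=> v w E; apply: matching_ker_inj => x y.
by split; apply: eq_kernel_partition.
Qed.

End MatchingInjection.

(** * Stable partitions and their numbers of blocks *)

Section StablePartitions.
Variable G : sgraph.
Implicit Types (P : {set {set G}}) (u v w x y : G).

Definition stable_partitions : {set {set {set G}}} :=
  [set P | partition P [set: G] && [forall A in P, stable A]].

(** Taking [F] constantly 1 yields B, and taking the identity yields T. *)
Lemma sum_colorings (F : nat -> nat) : 0 < #|G| ->
  \sum_(1 <= k < (graph_order G).+1) F k * num_colorings G k =
  \sum_(P in stable_partitions) F #|P|.
Proof.
move=> G_gt0.
transitivity (\sum_(1 <= k < #|G|.+1) \sum_(P in stable_partitions | #|P| == k) F k).
  apply: eq_bigr => k _; rewrite sum_nat_const mulnC; congr (_ * _).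
  by apply: eq_card => P; rewrite [LHS]inE andbA -topredE /= inE.
rewrite (exchange_big_dep (fun P => P \in stable_partitions)) //=; last first.
  by move=> k P _ /andP[].
apply: eq_bigr => P PS; have /setIdP[partP _] := PS.
(* Only [k = #|P|] contributes. It is in range: at most the order, and nonzero because an empty
   family covers no vertex. *)
rewrite (eq_bigl (fun k => k == #|P|)); last by move=> k; rewrite PS eq_sym.
rewrite big_nat1_eq ltnS (card_partition_setT partP) andbT lt0n.
case: eqP => //= /eqP; rewrite cards_eq0 => /eqP P0.
by move: G_gt0; rewrite -cardsT (card_partition partP) P0 big_set0.
Qed.

Lemma kernel_stable (f : G -> G) :
  (forall x y, f x = f y -> ~~ adj x y) ->
  kernel_partition f \in stable_partitions.
Proof.
move=> fadj; rewrite inE preim_partitionP; apply/forall_inP => A /imsetP[z _ ->].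
apply/forall_inP => x; rewrite !inE => /= /eqP zx.
by apply/forall_inP => y; rewrite !inE => /= /eqP zy; apply: fadj; rewrite -zx.
Qed.

Lemma discrete_stable : kernel_partition id \in stable_partitions.
Proof. by apply: kernel_stable => x _ <-; rewrite adj_irrefl. Qed.

Lemma stable_pblock P u v : P \in stable_partitions ->
  v \in pblock P u -> ~~ adj u v.
Proof.
rewrite inE => /andP[/and3P[/eqP cov _ _] /forall_inP st] vu.
have uu : u \in pblock P u by rewrite mem_pblock cov inE.
have /st/forall_inP/(_ u uu)/forall_inP : pblock P u \in P.
  by rewrite pblock_mem // cov inE.
exact.
Qed.

Lemma sum_card_stable_partitions : 0 < #|G| ->
  \sum_(P in stable_partitions) #|P|
    <= (#|G| - 1) * #|stable_partitions| + 1
    ?= iff [forall P in stable_partitions, #|G| - 1 <= #|P|].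
Proof.
move=> G_gt0.
(* The extra 1 is charged to the discrete partition, which makes the comparison term by term. *)
have -> : (#|G| - 1) * #|stable_partitions| + 1 =
    \sum_(P in stable_partitions) (#|G| - 1 + (P == kernel_partition id)).
  rewrite big_split /= sum_nat_const mulnC; congr (_ + _).
  rewrite (bigD1 (kernel_partition id)) ?discrete_stable //= eqxx.
  by rewrite big1 // => P /andP[_ /negPf->].
apply: leqif_sum => P; rewrite inE => /andP[/card_partition_setT[le_P eq_P] _].
rewrite -eq_P; case: eqP => [->|neq] /=.
  by rewrite subnK //; apply/leqifP; rewrite leq_subr.
rewrite addn0; have lt_P : #|P| <= #|G| - 1.
  by rewrite leq_subRL // add1n ltn_neqAle le_P andbT; apply/eqP.
by split=> //; rewrite eqn_leq lt_P.
Qed.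

End StablePartitions.

(** The complement of [G] is a star centred at [z]: in [G], [z] is isolated and the other vertices
    form a clique. *)
Definition dominated_by_pair (G : sgraph) (z : G) :=
  forall x y : G, adj x y = [&& x != y, x != z & y != z].

(** * Graphs in which every vertex has a non-neighbour *)

Section NoUniversalVertex.
Variables (G : sgraph) (f : G -> G).
Hypothesis f_neq : forall v, f v != v.
Hypothesis f_adj : forall v, ~~ adj v (f v).

Lemma glue_stable (u w : G) : ~~ adj u w -> kernel_partition (glue u w) \in stable_partitions G.
Proof.
move=> uw; apply: kernel_stable => x y.
by case/glue_inj=> [->|[-> ->]|[-> ->]]; rewrite ?adj_irrefl // adj_sym.
Qed.

Lemma glue2_stable (a b u w : G) :
  u != a -> u != b -> w != a -> w != b -> ~~ adj u w -> ~~ adj a b ->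
  kernel_partition (glue a b \o glue u w) \in stable_partitions G.
Proof.
move=> ua ub wa wb uw ab; apply: kernel_stable => x y /=.
case/glue2_inj=> // [/glue_inj[->|[-> ->]|[-> ->]]|[-> ->]|[-> ->]];
  by rewrite ?adj_irrefl // adj_sym.
Qed.

Lemma card_stable_partitions_ge : #|G| <= #|stable_partitions G|.
Proof.
case: (pickP (fun v => f (f v) == v)) => [a /eqP ffa|no_cycle].
  have ac : (exists v, f (f v) = v) -> f (f a) = a by [].
  rewrite -cardsT -(card_imset _ (kernel_matching_inj f_neq ac)).
  apply/subset_leq_card/subsetP=> _ /imsetP[v _ ->]; rewrite /matching.
  case fv: (cycle_first f v); last exact: glue_stable.
  case nv: (_ || _); first exact: discrete_stable.
  by have [] := cycle_first_disjoint ac fv (negbT nv) => *; apply: glue2_stable.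
have [->//|/card_gt0P[a _]] := posnP #|G|.
have ac : (exists v, f (f v) = v) -> f (f a) = a.
  by case=> v /eqP; rewrite no_cycle.
rewrite -cardsT -(card_imset _ (kernel_matching_inj f_neq ac)).
apply/subset_leq_card/subsetP=> _ /imsetP[v _ ->]; rewrite /matching.
by rewrite /cycle_first no_cycle; apply: glue_stable.
Qed.

(** * The complement in the equality case *)

Section FewMerges.
Hypothesis card_ge : forall P, P \in stable_partitions G -> #|G| - 1 <= #|P|.

Lemma few_merges (g : G -> G) u v : u != v ->
  kernel_partition g \in stable_partitions G ->
  (forall x, g x != u) -> (forall x, g x != v) -> False.
Proof.
move=> uv /card_ge ge gu gv.
have := leq_trans ge (card_kernel_partition_avoid2 uv gu gv).
(* For n = 1 the truncated n - 1 and n - 2 would coincide. *)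
have : 1 < #|G| by rewrite (cardD1 u) (cardD1 v) !inE eq_sym uv.
lia.
Qed.

(** Gluing two disjoint non-edges would leave at most n - 2 blocks, the composite map missing [a]
    and [u]. *)
Lemma nonadj_meet (a b u w : G) : a != b -> u != w -> ~~ adj a b -> ~~ adj u w ->
  [|| u == a, u == b, w == a | w == b].
Proof.
move=> nab nuw ab uw; apply: contraT; rewrite !negb_or => /and4P[ua ub wa wb].
case: (@few_merges (glue a b \o glue u w) a u); rewrite 1?eq_sym //.
- exact: glue2_stable.
- by move=> x; rewrite /= /glue; case: ifP => [_|/negbT //]; rewrite eq_sym.
- move=> x; rewrite /= /glue; case: ifP => [_|_]; first by rewrite eq_sym.
  by case: ifP => [_|/negbT //]; rewrite eq_sym.
Qed.

Lemma nonadj_triangle (a b c : G) : a != b -> a != c -> b != c ->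
  ~~ adj a b -> ~~ adj a c -> adj b c.
Proof.
move=> nab nac nbc ab ac; apply: contraT => bc.
pose g x := if (x == b) || (x == c) then a else x.
case: (@few_merges g b c) => //.
- apply: kernel_stable => x y; rewrite /g.
  case: ifP => [/orP xbc|_]; case: ifP => [/orP ybc|_].
  + by case: xbc ybc => /eqP-> [] /eqP->; rewrite ?adj_irrefl // adj_sym.
  + by move=> <-; case: xbc => /eqP->; rewrite adj_sym.
  + by move=> ->; case: ybc => /eqP->.
  + by move=> ->; rewrite adj_irrefl.
- by move=> x; rewrite /g; case: ifP => // /norP[].
- by move=> x; rewrite /g; case: ifP => // /norP[].
Qed.

Lemma exists_star_center : 0 < #|G| -> exists z : G, dominated_by_pair z.
Proof.
case/card_gt0P=> a _.
(* It suffices that [z] meets every non-edge: for [x] other than [z], [f x] can then only be [z], so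
   [z] is isolated. *)
suff [z zP] : exists z : G, forall x y, x != y -> ~~ adj x y -> (x == z) || (y == z).
  exists z.
  have adjz x : ~~ adj x z.
    have [->|xz] := eqVneq x z; first by rewrite adj_irrefl.
    have := zP x (f x); rewrite eq_sym f_neq f_adj (negPf xz) /=.
    by move=> /(_ isT isT)/eqP <-.
  move=> x y; have [->|xy] := eqVneq x y; first by rewrite adj_irrefl.
  have [->|xz] /= := eqVneq x z; first by rewrite adj_sym; apply/negbTE.
  have [->|yz] /= := eqVneq y z; first exact/negbTE.
  by apply: contraT => /(zP _ _ xy); rewrite (negPf xz) (negPf yz).
pose b := f a; have nab : a != b by rewrite eq_sym f_neq.
(* A non-edge must meet [{u, v}]; if [v] has no non-neighbour besides [u], it contains [u] in either
   case. *)
have star (u v : G) : u != v -> ~~ adj u v ->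
    (forall y, y != u -> y != v -> adj y v) ->
    forall x y, x != y -> ~~ adj x y -> (x == u) || (y == u).
  move=> nuv uv vP x y nxy xy; apply: contraT => /norP[xu yu].
  have := nonadj_meet nuv nxy uv xy; rewrite (negPf xu) (negPf yu) /=.
  case/orP=> /eqP E; subst.
    by move: xy; rewrite adj_sym vP // eq_sym.
  by move: xy; rewrite vP.
(* If [b] has a second non-neighbour [x], the centre is [b]: another non-neighbour of [a] would
   create two disjoint non-edges or a triangle of non-edges. Otherwise the centre is [a]. *)
case: (pickP (fun x => [&& x != a, x != b & ~~ adj x b])) => [x /and3P[xa xb adjx]|noP].
  exists b; apply: star (a) _ _ _; rewrite 1?eq_sym // 1?adj_sym ?f_adj //.
  move=> y yb ya; apply: contraT => adjy.
  have [E|nxy] := eqVneq x y.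
    move: adjy; rewrite -E in ya yb *.
    by rewrite adj_sym (@nonadj_triangle b a x) // 1?eq_sym // 1?adj_sym // f_adj.
  have := nonadj_meet xb ya adjx adjy.
  by rewrite eq_sym (negPf nxy) (negPf yb) eq_sym (negPf xa) (negPf nab).
exists a; apply: star (b) _ _ _; rewrite ?f_adj // => y ya yb.
by have := noP y; rewrite ya yb => /negbFE.
Qed.

End FewMerges.
End NoUniversalVertex.

(** * Stable partitions of a clique plus an isolated vertex *)

Section StarComplement.
Variables (G : sgraph) (z : G).
Hypothesis zP : dominated_by_pair z.

Lemma star_pblock P x y : P \in stable_partitions G -> x != z ->
  y \in pblock P x -> y = x \/ y = z.
Proof.
move=> PS xz /(stable_pblock PS); rewrite zP xz /=.
by case: (eqVneq x y) => [|_]; [left|case: eqVneq; [right|]].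
Qed.

(** The vertices other than [z] are pairwise adjacent, hence in distinct blocks. *)
Lemma card_star_stable_partition_ge P : P \in stable_partitions G -> #|G| - 1 <= #|P|.
Proof.
move=> PS; have := PS; rewrite inE => /andP[/and3P[/eqP cov tiP _] _].
have -> : #|G| - 1 = #|[set~ z]| by rewrite cardsCs setCK cards1.
rewrite -(@card_in_imset _ _ (pblock P)).
  by apply/subset_leq_card/subsetP=> _ /imsetP[x _ ->]; rewrite pblock_mem // cov inE.
move=> x y; rewrite !inE => xz yz E.
have : y \in pblock P x by rewrite E mem_pblock cov inE.
by case/(star_pblock PS xz)=> // E'; rewrite E' eqxx in yz.
Qed.

(** All blocks avoiding [z] are singletons. *)
Lemma pblock_star_inj : {in stable_partitions G &, injective (fun P => pblock P z)}.
Proof.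
move=> P Q PS QS /= E.
have sub P' Q' : P' \in stable_partitions G -> Q' \in stable_partitions G ->
    pblock P' z = pblock Q' z -> forall x y, y \in pblock P' x -> y \in pblock Q' x.
  move=> PS' QS' E' x y.
  have := PS'; rewrite inE => /andP[/and3P[/eqP cov tiP _] _].
  have := QS'; rewrite inE => /andP[/and3P[/eqP cov' tiQ _] _].
  have [->|xz] := eqVneq x z; first by rewrite E'.
  move=> yx; have [->|Ey] := star_pblock PS' xz yx; first by rewrite mem_pblock cov' inE.
  move: yx; rewrite Ey -!eq_pblock ?cov ?cov' ?inE // => /eqP Ex.
  rewrite eq_sym eq_pblock ?cov' ?inE // -E' -eq_pblock ?cov ?inE //.
  by rewrite Ex.
have := PS; have := QS; rewrite !inE => /andP[pQ _] /andP[pP _].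
rewrite -(equivalence_partition_pblock pP) -(equivalence_partition_pblock pQ).
apply: eq_imset => x; apply/setP=> y; rewrite !inE /=.
by apply/idP/idP; apply: sub.
Qed.

(** The block of [z] determines the partition and has the form [{z, x}], with [x = z] accounting for
    [{z}]. *)
Lemma card_star_stable_partitions_le : #|stable_partitions G| <= #|G|.
Proof.
rewrite -(card_in_imset pblock_star_inj) -cardsT.
rewrite -(card_imset _ (f := fun x => [set z; x])); last first.
  move=> x y /= /setP E; have := E x; have := E y; rewrite !inE !eqxx !orbT.
  by move/orP=> [/eqP->|/eqP->] // /esym/orP[/eqP->|/eqP->].
apply/subset_leq_card/subsetP=> _ /imsetP[P PS ->].
have := PS; rewrite inE => /andP[/and3P[/eqP cov tiP _] _].
have zz : z \in pblock P z by rewrite mem_pblock cov inE.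
have block x : x != z -> x \in pblock P z -> pblock P z = [set z; x].
  move=> xz xPz; apply/setP=> y; rewrite !inE; apply/idP/orP => [|[]/eqP-> //].
  rewrite -(same_pblock tiP xPz) => /(star_pblock PS xz)[]->; rewrite eqxx; auto.
case: (pickP (fun x => (x != z) && (x \in pblock P z))) => [x /andP[xz xP]|none].
  by apply/imsetP; exists x; rewrite ?inE //; apply: block.
apply/imsetP; exists z; rewrite ?inE //; apply/setP=> y; rewrite !inE orbb.
by have := none y; have [->|yz /=] := eqVneq y z; rewrite ?zz.
Qed.

End StarComplement.

(** * Isomorphism with the union of a clique and a point *)

Lemma star_isomorphic (G : sgraph) (z : G) : dominated_by_pair z ->
  isomorphic G (disjoint_union (complete_graph (#|G| - 1)) (complete_graph 1)).
Proof.
move=> zP.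
have cardz : #|G| - 1 = #|[set~ z]| by rewrite cardsCs setCK cards1.
(* Built from the union to [G], where [enum_val] lists the vertices other than [z]; the inverse is
   the isomorphism. *)
pose g (s : disjoint_union (complete_graph (#|G| - 1)) (complete_graph 1)) : G :=
  match s with inl i => enum_val (cast_ord cardz i) | inr _ => z end.
have gz i : enum_val (cast_ord cardz i) != z.
  by have := enum_valP (cast_ord cardz i); rewrite !inE.
have g_inj : injective g.
  move=> [i|i] [j|j] //= => [/enum_val_inj/cast_ord_inj-> //|E|E|_].
  - by have := gz i; rewrite E eqxx.
  - by have := gz j; rewrite -E eqxx.
  - by rewrite !ord1.
have [|h gK hK] := inj_card_bij g_inj.
  by rewrite card_sum !card_ord subnK //; apply/card_gt0P; exists z.
exists h; first by exists g.
move=> u v; rewrite -{2}[u]hK -{2}[v]hK zP (inj_eq g_inj).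
case: (h u) (h v) => [i|i] [j|j] /=; rewrite ?gz ?eqxx ?andbF ?andbT //.
by rewrite !ord1.
Qed.

Lemma isomorphic_star (G : sgraph) m :
  isomorphic G (disjoint_union (complete_graph m) (complete_graph 1)) ->
  exists z : G, dominated_by_pair z.
Proof.
case=> h [g hK gK] hadj; exists (g (inr ord0)) => x y.
have eqz u : (u == g (inr ord0)) = if h u is inr _ then true else false.
  apply/eqP/idP=> [->|]; first by rewrite gK.
  by case E: (h u) => [//|i] _; rewrite -(hK u) E ord1.
rewrite -hadj -(inj_eq (can_inj hK)) !eqz.
by case: (h x) (h y) => [i|i] [j|j]; rewrite /= ?andbF ?andbT ?[i]ord1 ?[j]ord1.
Qed.

(** * From the degree condition to the average *)

Lemma exists_nonneighbour (G : sgraph) (v : G) : degree v <= #|G| - 2 -> 1 < #|G| ->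
  exists2 w, w != v & ~~ adj v w.
Proof.
move=> dv G2; have : [set w | adj v w] \proper [set~ v].
  rewrite properEcard; apply/andP; split.
    by apply/subsetP=> w; rewrite !inE; apply: contraTneq => ->; rewrite adj_irrefl.
  by rewrite [X in _ < X]cardsCs setCK cards1; move: dv; rewrite /degree; lia.
by case/properP=> _ [w]; rewrite !inE => wv nw; exists w.
Qed.

Unset Implicit Arguments.

Theorem theorem12 (n : nat) (G : sgraph) (hn : (2 <= n)%N)
    (hG : graph_order G = n) (hD : max_degree G = (n - 2)%N) :
  (avg_colors G <= (n%:R ^+ 2 - n%:R + 1) / n%:R)%R /\
  (avg_colors G = ((n%:R ^+ 2 - n%:R + 1) / n%:R)%R <->
   isomorphic G (disjoint_union (complete_graph (n - 1)%N) (complete_graph 1))).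
Proof.
have cardG : #|G| = n by [].
have G_gt0 : 0 < #|G| by lia.
have ex_nn (v : G) : exists w, (w != v) && ~~ adj v w.
  have [||w wv vw] := @exists_nonneighbour G v; rewrite ?cardG //.
    by rewrite -hD; apply: leq_bigmax.
  by exists w; rewrite wv.
pose f v := xchoose (ex_nn v).
have f_neq v : f v != v by case/andP: (xchooseP (ex_nn v)).
have f_adj v : ~~ adj v (f v) by case/andP: (xchooseP (ex_nn v)).
have EB : total_colorings G = #|stable_partitions G|.
  rewrite -sum1_card -(sum_colorings (fun=> 1) G_gt0).
  by apply: eq_bigr => k _; rewrite mul1n.
have ET : total_colors G = \sum_(P in stable_partitions G) #|P|.
  exact: (sum_colorings id G_gt0).
have B_ge := card_stable_partitions_ge f_neq f_adj.
have [T_le T_eq] := sum_card_stable_partitions G_gt0.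
rewrite -EB -ET cardG in B_ge T_le T_eq.
have n_gt0 : (0 < n%:R :> rat)%R by rewrite ltr0n; lia.
have B_gt0 : (0 < (total_colorings G)%:R :> rat)%R by rewrite ltr0n; lia.
have -> : (n%:R ^+ 2 - n%:R + 1 = ((n - 1) * n + 1)%:R :> rat)%R.
  by rewrite natrD natrM natrB; [ring|lia].
rewrite /avg_colors ler_pdivrMr // mulrAC ler_pdivlMr // -!natrM ler_nat.
(* n T <= (n - 1) n B + n <= ((n - 1) n + 1) B, the last step because n <= B. *)
split; first by nia.
have eqE x y := eqr_div x y (lt0r_neq0 B_gt0) (lt0r_neq0 n_gt0).
split=> [/eqP|iso].
  rewrite eqE -!natrM eqr_nat => /eqP E.
  (* Equality together with T <= (n - 1) B + 1 forces B <= n, hence B = n. *)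
  have TE : total_colors G = (n - 1) * total_colorings G + 1 by nia.
  move/eqP: TE; rewrite T_eq => /forall_inP.
  rewrite -cardG => /(exists_star_center f_neq f_adj)/(_ G_gt0)[z zP].
  by have := star_isomorphic zP.
have [z zP] := isomorphic_star iso.
(* With the lower bound this gives B = n, so that T / B is the claimed value once T = (n - 1) B +
   1. *)
have B_le := card_star_stable_partitions_le zP; rewrite -EB cardG in B_le.
have : total_colors G == (n - 1) * total_colorings G + 1.
  by rewrite T_eq; apply/forall_inP => P /(card_star_stable_partition_ge zP); rewrite cardG.
by move=> /eqP ->; apply/eqP; rewrite eqE -!natrM eqr_nat; apply/eqP; nia.
Qed.
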